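(* Let $X$ be an ordered Banach space with positive cone $X_+ \neq \{0\}$, let $J = \mathbb{N}_0$ or $J = [0,\infty)$, and let $\mathcal{T} = (T_t)_{t \in J}$ be a positive operator semigroup on $X$. Suppose that the following two assumptions are satisfied: (a) For each vector $0 \neq x \in X_+$ there exists a time $t_x \in J$ such that $T_{t_x} x$ is an almost interior point of $X_+$. (b) The semigroup $\mathcal{T}$ is bounded and strongly asymptotically compact. Then $T_t$ converges strongly as $t \to \infty$. If the limit operator $Q := \lim_{t \to \infty} T_t$ (strong limit) is not zero, then it is of the form $Q = y' \otimes y$, where $y \in X$ is an almost interior point of $X_+$ and a fixed point of $\mathcal{T}$ (i.e. $T_t y = y$ for all $t \in J$), and $y' \in X'$ is a strictly positive functional and a fixed point of the adjoint semigroup $\mathcal{T}' := (T_t')_{t\in J}$ consisting of the dual operators (i.e. $T_t' y' = y'$ for all $t\in J$).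
   Context: An ordered Banach space is a real Banach space $X$ together with a non-empty closed subset $X_+ \subseteq X$ (the positive cone) such that $\alpha X_+ + \beta X_+ \subseteq X_+$ for all real $\alpha,\beta \ge 0$ and $X_+ \cap (-X_+) = \{0\}$. $X'$ is the dual Banach space of $X$, and a functional $x' \in X'$ is called positive if $\langle x',x\rangle \ge 0$ for all $x \in X_+$. A functional $x' \in X'$ is called strictly positive if $\langle x',x\rangle > 0$ for all $0 \neq x \in X_+$. A vector $x \in X$ is called an almost interior point of $X_+$ if $\langle x',x\rangle > 0$ for every non-zero positive functional $x' \in X'$. $\mathcal{L}(X)$ is the space of bounded linear operators on $X$. Let $J = \mathbb{N}_0 = \{0,1,2,\dots\}$ or $J = [0,\infty)$. An operator semigroup on $X$ is a family $(T_t)_{t \in J}$ in $\mathcal{L}(X)$ with $T_0 = \mathrm{id}$ and $T_{t+s} = T_tT_s$ for all $s,t \in J$; no continuity in $t$ is assumed. It is positive if $T_t X_+ \subseteq X_+$ for all $t \in J$, and bounded if $\sup_{t\in J}\|T_t\| < \infty$. It is strongly asymptotically compact if for each $x \in X$ and each sequence $(t_n)_{n \in \mathbb{N}}$ in $J$ with $t_n \to \infty$, the sequence $(T_{t_n}x)_{n\in\mathbb{N}}$ has a (norm) convergent subsequence. $T_t$ converges strongly to $Q \in \mathcal{L}(X)$ as $t \to \infty$ if $\|T_t x - Qx\| \to 0$ for all $x\in X$. For $y \in X$ and $y' \in X'$, the operator $y' \otimes y \in \mathcal{L}(X)$ is $(y'\otimes y)z = \langle y',z\rangle y$. *)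

(* Defs.v *)
From HB Require Import structures.
From mathcomp Require Export all_boot all_order all_algebra.
From mathcomp Require Export boolp classical_sets functions reals.
From mathcomp Require Export topology normedtype sequences.

Set Implicit Arguments.
Unset Strict Implicit.
Unset Printing Implicit Defensive.

Import Order.TTheory GRing.Theory Num.Theory.
Import numFieldNormedType.Exports.

Local Open Scope classical_set_scope.
Local Open Scope ring_scope.

Record bounded_operator (R : realType) (V W : normedModType R) :=
  BoundedOperator {
    operator :> {linear V -> W};
    operator_bounded : bounded_fun_norm operator }.

Definition dual_space (R : realType) (V : normedModType R) :=
  bounded_operator V R^o.

Definition opnorm (R : realType) (V W : normedModType R)
    (A : bounded_operator V W) : R :=
  sup [set `|A x| | x in [set x | `|x| <= 1]].

Section rank_one.
Variables (R : realType) (V : normedModType R).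
Variables (y' : dual_space V) (y : V).

Definition rank_one_fun (z : V) : V := y' z *: y.

Lemma rank_one_linear : linear rank_one_fun.
Proof. by move=> a u v; rewrite /rank_one_fun linearP scalerDl scalerA. Qed.

HB.instance Definition _ :=
  GRing.isLinear.Build R V V *:%R rank_one_fun rank_one_linear.

Lemma rank_one_bounded : bounded_fun_norm rank_one_fun.
Proof.
move=> r; have [M y'M] := operator_bounded y' r.
by exists (M * `|y|) => z /y'M zM; rewrite normrZ ler_wpM2r.
Qed.

(* y' (x) y *)
Definition rank_one : bounded_operator V V :=
  @BoundedOperator R V V rank_one_fun rank_one_bounded.

End rank_one.

Section dual_operator.
Variables (R : realType) (V : normedModType R).
Variables (A : bounded_operator V V) (x' : dual_space V).

Lemma dual_operator_bounded : bounded_fun_norm (x' \o A).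
Proof.
move=> r; have [M AM] := operator_bounded A r.
have [N x'N] := operator_bounded x' M.
by exists N => x /AM /x'N.
Qed.

(* A' x' *)
Definition dual_operator : dual_space V :=
  @BoundedOperator R V R^o (x' \o A) dual_operator_bounded.

End dual_operator.

Section ordered_banach_space.
Variables (R : realType) (X : completeNormedModType R).

Definition positive_cone (P : set X) :=
  [/\ P !=set0, closed P,
      forall (a b : R) (x y : X),
        0 <= a -> 0 <= b -> P x -> P y -> P (a *: x + b *: y) &
      P `&` [set - x | x in P] = [set 0]].

Definition positive_functional (P : set X) (x' : dual_space X) :=
  forall x, P x -> 0 <= x' x.

Definition strictly_positive (P : set X) (x' : dual_space X) :=
  forall x, P x -> x <> 0 -> 0 < x' x.

Definition almost_interior (P : set X) (x : X) :=
  forall x', positive_functional P x' -> ~ (x' =1 \0) -> 0 < x' x.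

End ordered_banach_space.

(* Both N_0 and [0, +oo[ are sets of real numbers, so that a family indexed by
   J is a function on R whose values outside J are irrelevant. *)
Definition time_set (R : realType) (J : set R) :=
  J = range (fun n : nat => n%:R) \/ J = [set t | 0 <= t].

Section semigroup.
Variables (R : realType) (X : completeNormedModType R) (J : set R).
Implicit Types (T : R -> bounded_operator X X).

Definition operator_semigroup T :=
  T 0 =1 id /\ forall s t, J s -> J t -> T (t + s) =1 T t \o T s.

Definition positive_semigroup (P : set X) T :=
  forall t, J t -> forall x, P x -> P (T t x).

Definition bounded_semigroup T := has_ubound [set opnorm (T t) | t in J].

Definition strongly_asymptotically_compact T :=
  forall (x : X) (t : nat -> R), (forall n, J (t n)) ->
    t n @[n --> \oo] --> +oo_R ->
    exists phi : nat -> nat, {homo phi : m n / (m < n)%N} /\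
      cvg (T (t (phi n)) x @[n --> \oo]).

Definition converges_strongly T (Q : bounded_operator X X) :=
  forall x : X, `|T t x - Q x| @[t --> within J +oo_R] --> (0 : R).

End semigroup.

(* Main.v *)
From HB Require Import structures.
From mathcomp Require Import ring lra.
Require Import Defs.

Set Implicit Arguments.
Unset Strict Implicit.
Unset Printing Implicit Defensive.

Import Order.TTheory GRing.Theory Num.Theory.
Import numFieldNormedType.Exports.

Local Open Scope classical_set_scope.
Local Open Scope ring_scope.

(** Call z recurrent if T s z comes back arbitrarily close to z at arbitrarily
    late times s.  Since orbits are asymptotically compact, every orbit
    accumulates somewhere, and it accumulates only at recurrent vectors
    ([omega_limit_recurrent]).  Everything therefore depends on the cone C of
    positive recurrent vectors.  The claim is that C lies on a single line
    through some y in C ([recurrent_cone_line]).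

    To see this, note that on recurrent vectors the semigroup is bounded below
    ([recurrent_lower_bound]), which forces any two recurrent vectors to come
    back at common times ([jointly_recurrent]); hence C is a closed convex cone.
    If C were not contained in a line, a Bishop-Phelps argument would yield a
    non-zero w in C and a functional x', non-negative on C, with x' w = 0 but
    x' v > 0 for some v in C ([support_functional]).  Now let t be such that
    T t w is almost interior, let s n be common return times of w and v, and
    consider an ultrafilter limit psi of the functionals x' (T (s n - t) _).
    All late values of x' along positive orbits are almost non-negative, because
    these orbits accumulate in C; so psi is a positive functional.  But
    psi (T t w) = x' w = 0 and psi (T t v) = x' v > 0, which contradicts that
    T t w is almost interior ([recurrent_cone_no_support]).

    The semigroup acts on the line through y by bounded and recurrent
    multiplication, so y is fixed ([recurrent_cone_fixed]).  The orbit of a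
    positive x comes close to some c y, and stays close since T is bounded and
    fixes c y; so it converges to c y ([orbit_cvg]).  The vectors with convergent
    orbit form a closed subspace, which is the whole space as soon as it contains
    P: a functional vanishing on P vanishes at an almost interior point, although
    it is positive ([almost_interior_total]).  The limit operator Q has range in
    the line through y, and if it is non-zero, then y is almost interior because
    it is fixed and non-zero.  Reading off the coefficient of y gives y'; strict
    positivity follows from y' x = y' (T t x) with T t x almost interior. *)

(** * Minimal sublinear functionals and the Hahn-Banach theorem *)

Section sublinear.
Variables (R : realType) (X : lmodType R).
Implicit Types (q : X -> R) (x y : X).

Definition sublinear q :=
  (forall x y, q (x + y) <= q x + q y) /\
  (forall t x, 0 < t -> q (t *: x) <= t * q x).

Lemma sublinear0 q : sublinear q -> q 0 = 0.
Proof.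
move=> [qD qZ]; have := qZ 2 0 ltac:(lra); have := qZ 2^-1 0 ltac:(lra).
by rewrite !scaler0; lra.
Qed.

Lemma sublinear_geN q x : sublinear q -> - q (- x) <= q x.
Proof.
by move=> qs; have := qs.1 x (- x); rewrite subrr (sublinear0 qs); lra.
Qed.

Lemma sublinearZ q t x : sublinear q -> 0 <= t -> q (t *: x) = t * q x.
Proof.
move=> qs; rewrite le_eqVlt => /predU1P[<-|t0].
  by rewrite scale0r mul0r sublinear0.
apply/le_anti; rewrite qs.2 //= -ler_pdivlMl //.
have := qs.2 t^-1 (t *: x); rewrite invr_gt0 => /(_ t0).
by rewrite scalerA mulVf ?gt_eqF // scale1r.
Qed.

(** Pointwise infima of families that are directed downwards in the following
    weak sense are sublinear.  Chains, one-sided slopes and inf-convolutions over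
    a cone are all of this form. *)
Lemma sublinear_inf (I : Type) (A : set I) (h : I -> X -> R) :
    A !=set0 ->
    (forall x, exists m, forall i, A i -> m <= h i x) ->
    (forall i j x y, A i -> A j ->
      exists2 k, A k & h k (x + y) <= h i x + h j y) ->
    (forall i t x, A i -> 0 < t -> exists2 k, A k & h k (t *: x) <= t * h i x) ->
  let q := fun x => inf [set h i x | i in A] in
  sublinear q /\ forall i x, A i -> q x <= h i x.
Proof.
move=> [i0 Ai0] hlb hD hZ q.
have qle i x : A i -> q x <= h i x.
  move=> Ai; apply: ge_inf; last by exists i.
  by have [m mP] := hlb x; exists m => _ [j Aj <-]; exact: mP.
have ne x : [set h i x | i in A] !=set0 by exists (h i0 x), i0.
split=> //; split=> [x y|t x t0].
  rewrite -lerBlDr; apply: lb_le_inf => // _ [i Ai <-].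
  rewrite lerBlDr -lerBlDl; apply: lb_le_inf => // _ [j Aj <-].
  rewrite lerBlDl; have [k Ak] := hD i j x y Ai Aj.
  exact: le_trans (qle _ _ _).
rewrite -ler_pdivrMl //; apply: lb_le_inf => // _ [i Ai <-].
rewrite ler_pdivrMl //; have [k Ak] := hZ i t x Ai t0.
exact: le_trans (qle _ _ _).
Qed.

(** The functional x |-> inf_(t >= 0) q (x + t x0) - t q x0 lies below q, and
    t = 1 gives its value at - x0.  For a minimal q it has to be q itself, whence
    q (- x0) = - q x0. *)
Lemma sublinear_slide q x0 : sublinear q ->
  exists q', [/\ sublinear q', forall x, q' x <= q x & q' (- x0) <= - q x0].
Proof.
move=> qs; pose h (t : R) x := q (x + t *: x0) - t * q x0.
have [||||q's q'le] := @sublinear_inf R [set t | 0 <= t] h.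
- by exists 0 => /=.
- move=> x; exists (- q (- x)) => t /= t0.
  have := qs.1 (x + t *: x0) (- x); rewrite addrC addKr /h.
  by rewrite (sublinearZ _ qs t0); lra.
- move=> s t x y /= s0 t0; exists (s + t) => /=; first exact: addr_ge0.
  have := qs.1 (x + s *: x0) (y + t *: x0).
  by rewrite addrACA -scalerDl /h; lra.
- move=> s t x /= s0 t0; exists (t * s) => /=; first exact: mulr_ge0 (ltW t0) _.
  by have := qs.2 t (x + s *: x0) t0; rewrite scalerDr scalerA /h; lra.
exists (fun x => inf [set h t x | t in [set t | 0 <= t]]); split => //.
- move=> x; apply: le_trans (q'le 0 x _) _ => //=.
  by rewrite /h scale0r addr0 mul0r subr0.
- apply: le_trans (q'le 1 _ _) _; first exact: ler01.
  by rewrite /h scale1r addNr mul1r (sublinear0 qs) sub0r.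
Qed.

(** Zorn's lemma applies since every sublinear p below q satisfies
    - q (- x) <= p x, so that infima of chains are finite. *)
Lemma sublinear_minimal q : sublinear q ->
  exists p, [/\ sublinear p, forall x, p x <= q x &
    forall p', sublinear p' -> (forall x, p' x <= p x) -> forall x, p x <= p' x].
Proof.
move=> qs; pose T := {p | sublinear p /\ forall x, p x <= q x}.
pose le (p1 p2 : T) := `[< forall x, sval p2 x <= sval p1 x >].
have q0 : T by exists q; split.
have [|||p pmax] := @ZL_preorder T q0 le.
- by move=> p; apply/asboolP => x.
- move=> p1 p2 p3 /asboolP h12 /asboolP h23; apply/asboolP => x.
  exact: le_trans (h23 x) (h12 x).
- move=> A Atot; have [->|/set0P A0] := eqVneq A set0; first by exists q0.
  have [|||ps ple] := @sublinear_inf T A (fun p => sval p) A0.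
  + move=> x; exists (- q (- x)) => -[p [ps pq]] Ap /=.
    by apply: le_trans (sublinear_geN x ps); rewrite lerN2.
  + move=> p1 p2 x y A1 A2.
    wlog /asboolP h : p1 p2 x y A1 A2 / le p1 p2.
      move=> th; case: (Atot _ _ A1 A2) => h; first exact: th h.
      have [k Ak hk] := th p2 p1 y x A2 A1 h.
      by exists k => //; rewrite addrC (addrC (sval p1 x)).
    by exists p2 => //; apply: le_trans ((svalP p2).1.1 x y) _; rewrite lerD2r.
  + by move=> p t x Ap t0; exists p => //; exact: (svalP p).1.2.
  have ipq : forall x, inf [set sval p x | p in A] <= q x.
    by case: A0 => p Ap x; apply: le_trans (ple p x Ap) ((svalP p).2 x).
  exists (exist _ (fun x => inf [set sval p x | p in A]) (conj ps ipq)) => p Ap.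
  by apply/asboolP => x /=; exact: ple.
exists (sval p); split; [exact: (svalP p).1|exact: (svalP p).2|].
move=> p' p's p'p.
have p'q x : p' x <= q x by apply: le_trans (p'p x) ((svalP p).2 x).
have /asboolP := pmax (exist _ p' (conj p's p'q)) ltac:(exact/asboolP).
exact.
Qed.

(** Minimal sublinear functionals are odd by [sublinear_slide], and an odd
    sublinear functional is linear; this avoids extending functionals from
    subspaces.  Sliding q along x0 before minimising pins the value at x0. *)
Theorem hahn_banach q x0 : sublinear q ->
  exists g : {linear X -> R^o}, (forall x, g x <= q x) /\ g x0 = q x0.
Proof.
move=> qs; have [q1 [q1s q1q q1x0]] := sublinear_slide x0 qs.
have [p [ps pq1 pmin]] := sublinear_minimal q1s.
(* p lies below its own slide along x, which is at most - p x at - x *)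
have pN x : p (- x) = - p x.
  apply/le_anti/andP; split; last first.
    by rewrite lerNl; have := sublinear_geN x ps.
  have [p' [p's p'p p'x]] := sublinear_slide x ps.
  exact: le_trans (pmin _ p's p'p _) p'x.
have pD x y : p (x + y) = p x + p y.
  apply/le_anti; rewrite ps.1 /=.
  have := ps.1 (x + y) (- y); rewrite addrK pN; lra.
have plin : linear (p : X -> R^o).
  move=> t x y; rewrite pD; congr (_ + _).
  have [t0|t0] := leP 0 t; first by rewrite (sublinearZ _ ps t0).
  rewrite -[t]opprK scaleNr pN sublinearZ //; last by rewrite oppr_ge0 ltW.
  by rewrite scaleNr.
pose g : {linear X -> R^o} := HB.pack (p : X -> R^o)
  (GRing.isLinear.Build R X R^o *:%R (p : X -> R^o) plin).
exists g; split.
- by move=> x; apply: le_trans (pq1 x) (q1q x).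
- apply/le_anti; rewrite (le_trans (pq1 x0) (q1q x0)) /=.
  by rewrite -lerN2 -pN (le_trans (pq1 _)).
Qed.

End sublinear.

(** * Separation and support of closed convex cones *)

Section bounded_operators.
Variables (R : realType) (V W : normedModType R).
Implicit Types A : bounded_operator V W.

Lemma bounded_operator_Lipschitz A :
  exists2 K : R, 0 <= K & forall x, `|A x| <= K * `|x|.
Proof.
have [K AK] := operator_bounded A 1.
have K0 : 0 <= K by apply: le_trans (AK 0 _); rewrite ?normr0.
exists K => // x; have [->|x0] := eqVneq x 0; first by rewrite linear0 !normr0 mulr0.
have nx : 0 < `|x| by rewrite normr_gt0.
have : `|A (`|x|^-1 *: x)| <= K.
  by apply: AK; rewrite normrZ ger0_norm ?invr_ge0 // mulVf ?gt_eqF.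
by rewrite linearZ normrZ ger0_norm ?invr_ge0 // mulrC ler_pdivrMr.
Qed.

Lemma le_opnorm A x : `|A x| <= opnorm A * `|x|.
Proof.
have [->|x0] := eqVneq x 0; first by rewrite linear0 !normr0 mulr0.
have nx : 0 < `|x| by rewrite normr_gt0.
rewrite -ler_pdivrMr // mulrC -[X in X * _]ger0_norm ?invr_ge0 // -normrZ -linearZ.
apply: ub_le_sup.
  by have [K AK] := operator_bounded A 1; exists K => _ [y y1 <-]; exact: AK.
by exists (`|x|^-1 *: x) => //=; rewrite normrZ ger0_norm ?invr_ge0 // mulVf ?gt_eqF.
Qed.

Lemma bounded_operator_of (g : {linear V -> W}) (K : R) :
  (forall x, `|g x| <= K * `|x|) -> exists A : bounded_operator V W, A =1 g.
Proof.
move=> gK; have gb : bounded_fun_norm g.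
  move=> r; exists (`|K| * `|r|) => x xr.
  apply: le_trans (gK x) _; apply: le_trans (ler_norm _) _.
  by rewrite normrM normr_id ler_wpM2l // (le_trans xr) // ler_norm.
by exists (BoundedOperator gb).
Qed.

Lemma bounded_operator_continuous A : continuous A.
Proof.
have [K K0 AK] := bounded_operator_Lipschitz A.
apply/linear_bounded_continuous/ex_bound; exists K.
apply: filterS (nbhs0_le (@ltr01 R)) => x x1.
by apply: le_trans (AK x) _; rewrite ler_piMr.
Qed.

End bounded_operators.

Lemma functionalZ (R : realType) (X : normedModType R) (f : {linear X -> R^o})
  (t : R) x : f (t *: x) = t * f x.
Proof. exact: linearZ. Qed.

Section convex_cones.
Variables (R : realType) (X : normedModType R).
Implicit Types (C : set X) (x : X).

Definition convex_cone C := C !=set0 /\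
  forall (a b : R) x y, 0 <= a -> 0 <= b -> C x -> C y -> C (a *: x + b *: y).

Lemma convex_cone0 C : convex_cone C -> C 0.
Proof.
move=> [[x Cx] CD]; have := CD 0 0 x x (lexx _) (lexx _) Cx Cx.
by rewrite !scale0r addr0.
Qed.

Lemma convex_coneD C x y : convex_cone C -> C x -> C y -> C (x + y).
Proof. by move=> [_ CD] Cx Cy; rewrite -[x]scale1r -[y]scale1r; apply: CD. Qed.

Lemma convex_coneZ C t x : convex_cone C -> 0 <= t -> C x -> C (t *: x).
Proof.
by move=> [_ CD] t0 Cx; rewrite -[_ *: _]addr0 -(scale0r x); apply: CD.
Qed.

(** Inf-convolution of f on C with a multiple of the norm.  A linear g below it
    has norm at most a and satisfies f + g >= 0 on C.  For f = 0 and a = 1 it is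
    the distance to - C. *)
Lemma sublinear_cone C (f : {linear X -> R^o}) (a : R) :
    convex_cone C -> 0 <= a -> (forall c, C c -> - (a * `|c|) <= f c) ->
  let q := fun x => inf [set f c + a * `|x + c| | c in C] in
  [/\ sublinear q, forall c, C c -> q (- c) <= f c & forall x, q x <= a * `|x|].
Proof.
move=> Cc a0 fa.
have [|||q qle] :=
  @sublinear_inf R X X C (fun c x => f c + a * `|x + c|) Cc.1.
- move=> x; exists (- (a * `|x|)) => c Cc'; have := fa c Cc'.
  have : a * `|c| <= a * `|x + c| + a * `|x|.
    rewrite -mulrDr ler_wpM2l // -{1}(addKr x c) addrC (le_trans (ler_normB _ _)) //.
  lra.
- move=> c d x y Cc' Cd; exists (c + d); first exact: convex_coneD.
  rewrite linearD addrACA [leRHS]addrACA lerD2l -mulrDr ler_wpM2l //.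
  exact: ler_normD.
- move=> c t x Cc' t0; exists (t *: c); first exact: convex_coneZ (ltW t0) _.
  by rewrite linearZ -scalerDr normrZ (gtr0_norm t0) mulrDr lerD2l mulrCA.
split=> // [c Cc'|x].
  by apply: le_trans (qle c _ Cc') _; rewrite addNr normr0 mulr0 addr0.
by apply: le_trans (qle 0 _ (convex_cone0 Cc)) _; rewrite linear0 add0r addr0.
Qed.

Lemma dominated_functional (g : {linear X -> R^o}) (a : R) :
  (forall x, g x <= a * `|x|) -> exists x' : dual_space X, x' =1 g.
Proof.
move=> ga; apply: (@bounded_operator_of _ _ _ g a) => x.
rewrite ler_norml ga andbT lerNl -linearN (le_trans (ga _)) // normrN //.
Qed.

(** A linear functional below the distance to - C, chosen to agree with that
    distance at - x0, is non-negative on C. *)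
Lemma cone_separation C x0 : convex_cone C -> closed C -> ~ C x0 ->
  exists x' : dual_space X, (forall c, C c -> 0 <= x' c) /\ x' x0 < 0.
Proof.
move=> Cc Ccl nC.
have [d d0 dC] : exists2 d : R, 0 < d & forall c, C c -> d <= `|x0 - c|.
  have : nbhs x0 (~` C) by apply: open_nbhs_nbhs; split => //; exact: closed_openC.
  move=> /nbhs_ballP[d /= d0 dC]; exists d => // c Cc'.
  rewrite leNgt; apply/negP => dc.
  by apply: (dC c) => //; rewrite -ball_normE.
have [|qs qN qle] := sublinear_cone (f := \0) Cc ler01.
  by move=> c _; rewrite /= mul1r oppr_le0.
have [g [gq gx0]] := hahn_banach (- x0) qs.
have [|x' x'E] := @dominated_functional g 1.
  by move=> x; apply: le_trans (gq x) (qle x).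
exists x'; split => [c Cc'|].
  by rewrite x'E -oppr_le0 -linearN (le_trans (gq _)) // qN.
rewrite x'E -oppr_gt0 -linearN gx0 (lt_le_trans d0) //.
apply: lb_le_inf; first by case: Cc.1 => c Cc'; exists (\0 c + 1 * `|- x0 + c|), c.
by move=> _ [c Cc' <-]; rewrite /= add0r mul1r -normrN opprD opprK; exact: dC.
Qed.

(** A functional that fails to be non-negative on C by at most a multiple of the
    norm becomes non-negative after a perturbation of that size. *)
Lemma cone_sandwich C (f : dual_space X) (a : R) : convex_cone C -> 0 <= a ->
    (forall c, C c -> - (a * `|c|) <= f c) ->
  exists x' : dual_space X,
    (forall c, C c -> 0 <= x' c) /\ forall x, f x - a * `|x| <= x' x.
Proof.
move=> Cc a0 fa; have [qs qN qle] := sublinear_cone Cc a0 fa.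
have [g [gq _]] := hahn_banach 0 qs.
have [K K0 fK] := bounded_operator_Lipschitz f.
have gle x : g x <= a * `|x| by exact: le_trans (gq x) (qle x).
have [|x' x'E] := @dominated_functional (f \+ g) (K + a).
  by move=> x /=; rewrite mulrDl lerD // (le_trans (ler_norm _)).
exists x'; split => [c Cc'|x]; rewrite x'E /=.
  by have := le_trans (gq _) (qN c Cc'); rewrite linearN; lra.
by have := gle (- x); rewrite linearN normrN; lra.
Qed.

End convex_cones.

Section support.
Variables (R : realType) (X : completeNormedModType R).
Implicit Types (C : set X).

(** Ekeland's variational principle.  From c one moves to a point of S c whose
    value is at least halfway down to the infimum of f over S c; the values then
    converge, hence so do the points, and the limit leaves no room to move. *)
Lemma ekeland C (f : X -> R) (a : R) w0 : closed C -> continuous f -> 0 < a ->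
    (exists m, forall c, C c -> m <= f c) -> C w0 ->
  exists w, [/\ C w, f w + a * `|w - w0| <= f w0 &
    forall c, C c -> f w <= f c + a * `|c - w|].
Proof.
move=> Ccl fc a0 [m fm] Cw0.
pose S c := [set c' | C c' /\ f c' + a * `|c' - c| <= f c].
have Strans c1 c2 c3 : S c1 c2 -> S c2 c3 -> S c1 c3.
  move=> [_ h12] [Cc3 h23]; split=> //.
  have : a * `|c3 - c1| <= a * `|c3 - c2| + a * `|c2 - c1|.
    by rewrite -mulrDr ler_wpM2l ?(ltW a0) // -[c3 - c1](subrKA c2) ler_normD.
  lra.
have Srefl c : C c -> S c c by move=> ?; split=> //; rewrite subrr normr0 mulr0 addr0.
have Scl c : closed (S c).
  apply: closedI => //.
  apply: (@preimage_closed _ _ (fun x => f x + a * `|x - c|) [set r | r <= f c]).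
    move=> x _; apply: cvgD; first exact: fc.
    apply: cvgMl_tmp; apply: cvg_norm; apply: cvgB; [exact: cvg_id|exact: cvg_cst].
  exact: closed_le.
have step (c : {c | C c}) : {c' : {c | C c} | S (sval c) (sval c') /\
    forall d, S (sval c) d -> f (sval c') - f d <= f (sval c) - f (sval c')}.
  case: c => c Cc; apply: cid => /=; set E := [set f d | d in S c].
  have Elb : has_lbound E by exists m => _ [d [Cd _] <-]; exact: fm.
  have E0 : E !=set0 by exists (f c), c => //; exact: Srefl.
  have infc : inf E <= f c by apply: ge_inf => //; exists c => //; exact: Srefl.
  move: infc; rewrite le_eqVlt => /predU1P[Ec|Ec].
    exists (exist _ c Cc); split=> [|d Sd /=]; first exact: Srefl.
    by rewrite subrr subr_le0 -Ec; apply: ge_inf => //; exists d.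
  have [_ [d Sd <-] dE] :=
    @inf_adherent _ E ((f c - inf E) / 2) ltac:(lra) (conj E0 Elb).
  exists (exist _ d Sd.1); split=> //= d' Sd'.
  have : inf E <= f d' by apply: ge_inf => //; exists d'.
  lra.
have [s [s0 sP]] := dependent_choice step (exist _ w0 Cw0).
pose u n := sval (s n).
have uS n k : S (u n) (u (n + k)%N).
  elim: k => [|k IH]; first by rewrite addn0; exact: Srefl (svalP (s n)).
  by rewrite addnS; apply: Strans IH (sP _).1.
have Sle c c' : S c c' -> f c' <= f c.
  by move=> [_]; apply: le_trans; rewrite lerDl mulr_ge0 // ltW.
have fu_cvg : cvgn (f \o u).
  apply: nonincreasing_is_cvgn.
    by move=> i j ij /=; rewrite -(subnKC ij); exact: Sle.
  by exists m => _ [n _ <-]; exact: fm (svalP (s n)).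
set l := limn (f \o u) in fu_cvg.
have lfu n : l <= f (u n).
  apply: limr_le => //; exists n => // k /= nk; rewrite -(subnKC nk).
  exact: Sle.
have lnear (e : R) : 0 < e -> exists n, f (u n) < l + e.
  move=> e0; have /cvgrPdist_lt/(_ e e0)[n _ /(_ n (leqnn n))] := fu_cvg.
  by rewrite -/l /= distrC => /ltr_normlW; exists n; lra.
have u_cvg : cvgn u.
  apply/cauchy_cvgP/cauchy_exP => e e0.
  have [n ne] := lnear (a * e) (mulr_gt0 a0 e0).
  exists (u n), n => // k /= nk; rewrite -ball_normE /= distrC -(ltr_pM2l a0).
  have := (uS n (k - n)%N).2; rewrite subnKC // => h.
  by have := lfu k; lra.
have Sw n : S (u n) (limn u).
  apply: (closed_cvg (S (u n))) u_cvg => //.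
  by exists n => // k /= nk; rewrite -(subnKC nk); exact: uS.
have Cw := (Sw 0%N).1.
exists (limn u); split=> // [|c Cc]; first by have := (Sw 0%N).2; rewrite /u s0.
rewrite leNgt; apply/negP => lt_c.
have Swc : S (limn u) c by split=> //; exact: ltW.
suff : f (limn u) <= f c by have := mulr_ge0 (ltW a0) (normr_ge0 (c - limn u)); lra.
apply/ler_addgt0Pr => e /lnear[n ne].
have := (sP n).2 c (Strans _ _ _ (Sw n) Swc); rewrite -/(u n) -/(u n.+1).
have := Sle _ _ (Sw n.+1); have := lfu n.+1; lra.
Qed.

(** A version of the Bishop-Phelps theorem.  Sliding u along - v up to the
    boundary of C gives w0 <> 0 in C with w0 - e v outside C for every e > 0.
    Separate w0 - e v from C by f and minimise f on C up to a slope a.  The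
    minimiser w is the boundary point: f + a |.| is non-negative in all
    directions c - t w pointing into C, so [cone_sandwich] corrects f to a
    functional that is non-negative on C and vanishes at w.  Both requirements
    on a, that w stays away from 0 and that the correction keeps the value at v
    positive, are met if e is small compared with |w0| / |v|. *)
Lemma support_functional C v : convex_cone C -> closed C -> C v -> ~ C (- v) ->
    (exists2 x, C x & forall t : R, x <> t *: v) ->
  exists (w : X) (x' : dual_space X),
    [/\ C w, w <> 0, forall c, C c -> 0 <= x' c, x' w = 0 & 0 < x' v].
Proof.
move=> Cc Ccl Cv nCv [u Cu uv].
have v0 : 0 < `|v|.
  by rewrite normr_gt0; apply/eqP => v0; apply: nCv; rewrite v0 oppr0 -v0.
have vcont (x : X) : continuous (fun t : R => x - t *: v).
  move=> t; apply: cvgB; first exact: cvg_cst.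
  apply: cvgZr_tmp; exact: cvg_id.
pose A := [set t : R | C (u - t *: v)].
have Acl : closed A.
  by apply: (@preimage_closed _ _ (fun t : R => u - t *: v) C) => // t _; exact: vcont.
have A0 : A 0 by rewrite /A /= scale0r subr0.
have Aub : has_ubound A.
  have : nbhs (- v) (~` C) by apply: open_nbhs_nbhs; split => //; exact: closed_openC.
  move=> /nbhs_ballP[d /= d0 dC]; exists (`|u| / d) => t At.
  have [t0|t0] := leP t 0; first by rewrite (le_trans t0) // divr_ge0 // ltW.
  rewrite ler_pdivlMr // leNgt; apply/negP => ut.
  apply: (dC (t^-1 *: (u - t *: v))); last first.
    by apply: convex_coneZ => //; rewrite invr_ge0 ltW.
  rewrite -ball_normE /= scalerBr scalerA mulVf ?gt_eqF // scale1r.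
  rewrite opprB addKr normrN normrZ gtr0_norm ?invr_gt0 //.
  by rewrite ltr_pdivrMl.
have sA : A (sup A) by apply: Acl; apply: closure_sup => //; exists 0.
set w0 := u - sup A *: v in sA.
have w00 : 0 < `|w0|.
  by rewrite normr_gt0 subr_eq0; apply/eqP; exact: uv.
pose e := `|w0| / (2 * `|v|).
have e0 : 0 < e by rewrite divr_gt0 ?mulr_gt0 //; lra.
have nC : ~ C (w0 - e *: v).
  rewrite /w0 -addrA -opprD -scalerDl => /(ub_le_sup Aub).
  by rewrite gerDl leNgt e0.
have [f [fC]] := cone_separation Cc Ccl nC.
rewrite linearB functionalZ subr_lt0 => few.
have fv0 : 0 < f v.
  by rewrite -(pmulr_rgt0 _ e0) (le_lt_trans _ few) // fC.
pose a : R := f v / (2 * `|v|).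
have a0 : 0 < a by rewrite divr_gt0 ?mulr_gt0 //; lra.
have [|w [Cw ww0 wmin]] := ekeland Ccl (@bounded_operator_continuous _ _ _ f) a0 _ sA.
  by exists 0; exact: fC.
have wn0 : w <> 0.
  move=> w_0; move: ww0; rewrite w_0 linear0 add0r sub0r normrN.
  have -> : a * `|w0| = e * f v by rewrite /a /e; field; rewrite gt_eqF.
  by move=> /le_lt_trans/(_ few); rewrite ltxx.
pose D := [set d | exists c t, C c /\ d = c - t *: w].
have CD c : C c -> D c by exists c, 0; rewrite scale0r subr0.
have Dc : convex_cone D.
  split; first by exists v; exact: CD.
  move=> s t _ _ s0 t0 [c [r [Cc' ->]]] [d [r' [Cd ->]]].
  exists (s *: c + t *: d), (s * r + t * r'); split; first exact: Cc.2.
  by rewrite !scalerBr !scalerA addrACA -opprD -scalerDl.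
(* w + r d lies in C once r t <= 1, and f varies linearly along the segment *)
have fD d : D d -> - (a * `|d|) <= f d.
  move=> [c [t [Cc' dE]]]; pose r : R := (1 + `|t|)^-1.
  have r0 : 0 < r by rewrite invr_gt0 ltr_pwDl.
  have Cr : C (w + r *: d).
    rewrite dE scalerBr scalerA addrCA -[w in w - _]scale1r -scalerBl addrC.
    apply: Cc.2 => //; last exact: ltW.
    rewrite subr_ge0 /r mulrC ler_pdivrMr ?ltr_pwDl // mul1r.
    by rewrite (le_trans (ler_norm _)) // lerDr.
  have := wmin _ Cr; rewrite [w + _]addrC addrK normrZ (gtr0_norm r0).
  rewrite linearD functionalZ [_ + f w]addrC -addrA lerDl mulrCA.
  rewrite -mulrDr pmulr_rge0 //; lra.
have [x' [x'D x'f]] := cone_sandwich Dc (ltW a0) fD.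
exists w, x'; split=> // [c /CD/x'D//||].
  apply/le_anti; rewrite (x'D _ (CD _ Cw)) andbT -oppr_ge0 -linearN.
  by apply: x'D; exists 0, 1; rewrite scale1r sub0r; split=> //; exact: convex_cone0.
apply: lt_le_trans (x'f v).
have -> : a * `|v| = f v / 2 by rewrite /a; field; rewrite gt_eqF.
lra.
Qed.

End support.

(** * Unbounded sets of times and ultrafilter limits *)

Section time_sets.
Variables (R : realType) (J : set R).
Hypothesis hJ : time_set J.

Lemma time_ge0 t : J t -> 0 <= t.
Proof. by case: hJ => -> // [n _ <-]; exact: ler0n. Qed.

Lemma time0 : J 0.
Proof. by case: hJ => ->; [exists 0%N|exact: lexx]. Qed.

Lemma timeD s t : J s -> J t -> J (s + t).
Proof.
case: hJ => -> /=; last exact: addr_ge0.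
by move=> [m _ <-] [n _ <-]; exists (m + n)%N; rewrite // natrD.
Qed.

Lemma timeB s t : J s -> J t -> s <= t -> J (t - s).
Proof.
case: hJ => -> /=; last by rewrite subr_ge0.
by move=> [m _ <-] [n _ <-]; rewrite ler_nat => mn; exists (n - m)%N; rewrite // natrB.
Qed.

Lemma time_unbounded (a : R) : exists2 t, J t & a <= t.
Proof.
exists (Num.bound `|a|)%:R.
  by case: hJ => -> /=; [exists (Num.bound `|a|)|exact: ler0n].
by rewrite (le_trans (ler_norm a)) // ltW // archi_boundP.
Qed.

Lemma near_timeP (A : set R) : (\forall t \near within J +oo_R, A t) <->
  exists a, forall t, J t -> a <= t -> A t.
Proof.
split=> [[a [_ aA]]|[a aA]].
  by exists (a + 1) => t Jt at1; apply: aA => //; rewrite (lt_le_trans _ at1) // ltrDl.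
by exists a; split=> [|t /ltW at_ Jt]; [exact: num_real|exact: aA].
Qed.

Lemma proper_within_time : ProperFilter (within J +oo_R).
Proof.
apply: Build_ProperFilter => /near_timeP[a aF].
by have [t Jt at_] := time_unbounded a; exact: aF at_.
Qed.

End time_sets.

(** Along a fixed ultrafilter all bounded sequences converge at once, so that the
    limit depends linearly on the sequence. *)
Lemma ultrafilter_cvg (R : realType) (U : set_system nat) (g : nat -> R) (B : R) :
  UltraFilter U -> (forall n, `|g n| <= B) -> cvg (g @ U).
Proof.
move=> UU gB; have UP := ultra_proper (F := U).
have gU : ProperFilter (g @ U) by exact: fmap_proper_filter.
have [|l [_ lU]] := @segment_compact R (- B) B (g @ U) gU.
  by apply: (@filterE _ U) => n /=; rewrite in_itv /= -ler_norml.
apply/cvg_ex; exists l => V Vl; rewrite nbhs_simpl.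
have [//|UnV] := in_ultra_setVsetC (g @^-1` V) UU.
by have [r [/= nVr /nVr]] := lU (~` V) V UnV Vl.
Qed.

(** * Recurrent vectors of a bounded asymptotically compact semigroup *)

Lemma bounded_semigroup_unif (R : realType) (X : completeNormedModType R)
    (J : set R) (T : R -> bounded_operator X X) :
  bounded_semigroup J T ->
  exists2 M : R, 1 <= M & forall t x, J t -> `|T t x| <= M * `|x|.
Proof.
move=> [M MT]; exists (Num.max 1 M); first by rewrite le_max lexx.
move=> t x Jt; rewrite (le_trans (le_opnorm _ _)) // ler_wpM2r //.
by rewrite le_max MT ?orbT //; exists t.
Qed.

Lemma later_index (R : realType) (t : nat -> R) (N : nat) (a : R) :
  (forall n, n%:R <= t n) ->
  exists2 m, (N <= m)%N & t N + a <= t m /\ t N <= t m.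
Proof.
move=> tn; pose b := `|t N| + `|a|.
have bm : b <= t (maxn N (Num.bound b)).
  apply: le_trans (tn _); apply: (@le_trans _ _ (Num.bound b)%:R).
    by rewrite ltW // archi_boundP // addr_ge0.
  by rewrite ler_nat leq_maxr.
exists (maxn N (Num.bound b)); first exact: leq_maxl.
by split; apply: le_trans bm; rewrite ?lerD ?ler_norm // ler_wpDr // ler_norm.
Qed.

Section recurrence.
Variables (R : realType) (X : completeNormedModType R) (J : set R).
Variables (T : R -> bounded_operator X X) (M : R).
Hypothesis hJ : time_set J.
Hypothesis hT : operator_semigroup J T.
Hypothesis M1 : 1 <= M.
Hypothesis TM : forall t x, J t -> `|T t x| <= M * `|x|.
Implicit Types (x z : X).

(** The recurrent vectors turn out to be the reversible part in the
    Jacobs-de Leeuw-Glicksberg splitting of T.  This definition needs no limit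
    group of operators. *)
Definition recurrent z := forall (e a : R), 0 < e ->
  exists s, [/\ J s, a <= s & `|T s z - z| <= e].

Let M0 : 0 < M. Proof. exact: lt_le_trans M1. Qed.

Lemma semigroup_sub s t z : J s -> J t -> s <= t -> T t z = T (t - s) (T s z).
Proof.
move=> Js Jt st; rewrite -[in LHS](subrK s t).
exact: hT.2 s (t - s) Js (timeB hJ Js Jt st) z.
Qed.

Lemma semigroup_comm s t z : J s -> J t -> T s (T t z) = T t (T s z).
Proof.
by move=> Js Jt; rewrite -[LHS](hT.2 t s Jt Js z) addrC [LHS](hT.2 s t Js Jt z).
Qed.

(** After time s the orbit of z still returns to z, so T s z cannot be small. *)
Lemma recurrent_lower_bound s z : recurrent z -> J s -> `|z| <= M * `|T s z|.
Proof.
move=> rz Js; apply/ler_addgt0Pr => e e0.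
have [r [Jr sr rzz]] := rz e s e0.
have zr : `|z| <= `|T r z| + `|z - T r z|.
  by rewrite -[X in `|X| <= _](subrKC (T r z)) ler_normD.
rewrite (le_trans zr) // lerD //; last by rewrite distrC.
by rewrite (semigroup_sub _ Js Jr sr) TM //; exact: timeB.
Qed.

(** Separate recurrence of z and z' would not suffice for this argument: the
    return times have to be common.  They are for z and T t z, and by
    [jointly_recurrent] for any two recurrent vectors. *)
Lemma recurrent_linear_combination z z' : (forall (e a : R), 0 < e -> exists s,
    [/\ J s, a <= s, `|T s z - z| <= e & `|T s z' - z'| <= e]) ->
  forall b b' : R, recurrent (b *: z + b' *: z').
Proof.
move=> rzz b b' e a e0.
have b0 : 0 < `|b| + `|b'| + 1 by rewrite ltr_wpDl ?addr_ge0.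
have [s [Js as_ sz sz']] := rzz (e / (`|b| + `|b'| + 1)) a (divr_gt0 e0 b0).
exists s; split => //; rewrite linearD !linearZ opprD addrACA -!scalerBr.
rewrite (le_trans (ler_normD _ _)) // !normrZ.
rewrite (le_trans (lerD (ler_wpM2l _ sz) (ler_wpM2l _ sz'))) // -mulrDl.
rewrite mulrCA ler_piMr //; first exact: ltW.
by rewrite ler_pdivrMr // mul1r lerDl.
Qed.

Lemma recurrent_semigroup t z : J t -> recurrent z -> recurrent (T t z).
Proof.
move=> Jt rz e a e0; have [s [Js as_ sz]] := rz (e / M) a (divr_gt0 e0 M0).
exists s; split=> //; rewrite semigroup_comm // -linearB (le_trans (TM _ Jt)) //.
by rewrite mulrC -ler_pdivlMr.
Qed.

Lemma recurrent_displacement t z : J t -> recurrent z -> recurrent (T t z - z).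
Proof.
move=> Jt rz; rewrite -[T t z]scale1r -[X in - X]scale1r -scaleNr.
apply: recurrent_linear_combination => e a e0; have [s [Js as_ sz]] := rz (e / M) a (divr_gt0 e0 M0).
exists s; split=> //; last by rewrite (le_trans sz) // ler_pdivrMr // ler_peMr // ltW.
rewrite semigroup_comm // -linearB (le_trans (TM _ Jt)) //.
by rewrite mulrC -ler_pdivlMr.
Qed.

(** If an orbit of a recurrent vector comes close to a point it has visited
    before, then the elapsed time is a return time of the vector itself. *)
Lemma recurrent_gap s t z : recurrent z -> J s -> J t -> s <= t ->
  `|T (t - s) z - z| <= M * `|T t z - T s z|.
Proof.
move=> rz Js Jt st; have Jts := timeB hJ Js Jt st.
rewrite (semigroup_sub z Js Jt st) -semigroup_comm // -linearB.
by apply: recurrent_lower_bound => //; exact: recurrent_displacement.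
Qed.

Lemma closed_recurrent : closed [set z | recurrent z].
Proof.
move=> z clz e a e0; have d0 : 0 < e / (M + 2) by rewrite divr_gt0 // addr_gt0.
have [z' [rz']] := clz _ (nbhsx_ballx z _ d0); rewrite -ball_normE /= => zz'.
have [s [Js as_ sz']] := rz' _ a d0; exists s; split=> //.
rewrite -(subrKA (T s z')) -linearB -[T s z' - z](subrKA z').
rewrite (le_trans (ler_normD _ _)) //.
have := TM (z - z') Js; have := ler_normD (T s z' - z') (z' - z).
rewrite (distrC z' z).
have : M * `|z - z'| <= M * (e / (M + 2)) by rewrite ler_pM2l // ltW.
have -> : M * (e / (M + 2)) = e - 2 * (e / (M + 2)).
  by field; rewrite gt_eqF // addr_gt0.
move: zz' sz'; lra.
Qed.

Hypothesis T_compact : strongly_asymptotically_compact J T.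

Lemma asymptotic_subsequence x (t : nat -> R) :
    (forall n, J (t n)) -> (forall n, n%:R <= t n) ->
  exists phi : nat -> nat,
    (forall n, (n <= phi n)%N) /\ cvg (T (t (phi n)) x @[n --> \oo]).
Proof.
move=> Jt tn; have [|phi [phi_incr phi_cvg]] := T_compact x Jt.
  by apply: (ger_cvgy _ (@cvgr_idn R)); apply: nearW.
exists phi; split=> // n; elim: n => // n IH; exact: leq_ltn_trans IH (phi_incr _ _ _).
Qed.

(** If the orbit of x is near z at two times far apart, the elapsed time carries
    z back to near itself. *)
Lemma omega_limit_recurrent x z (t : nat -> R) :
    (forall n, J (t n)) -> (forall n, n%:R <= t n) ->
  T (t n) x @[n --> \oo] --> z -> recurrent z.
Proof.
move=> Jt tn /cvgrPdist_le tz e a e0.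
have d0 : 0 < e / (M + 1) by rewrite divr_gt0 // addr_gt0.
have [N _ tzN] := tz _ d0.
have [m Nm [tma tNm]] := later_index N a tn.
have JNm := timeB hJ (Jt N) (Jt m) tNm.
exists (t m - t N); split=> //; first by rewrite lerBrDl.
rewrite -(subrKA (T (t m) x)) (semigroup_sub x (Jt N) (Jt m) tNm) -linearB.
rewrite -semigroup_sub // (le_trans (ler_normD _ _)) //.
have := TM (z - T (t N) x) JNm; have := tzN N (leqnn _); have := tzN m Nm.
rewrite /= (distrC z (T (t m) x)) => h1 h2 h3.
have : M * `|z - T (t N) x| <= M * (e / (M + 1)) by rewrite ler_pM2l.
have -> : M * (e / (M + 1)) = e - e / (M + 1) by field; rewrite gt_eqF // addr_gt0.
lra.
Qed.

(** Along a common sequence of times both orbits converge, so by [recurrent_gap]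
    late differences of these times are return times of both vectors. *)
Lemma jointly_recurrent z z' : recurrent z -> recurrent z' ->
  forall (e a : R), 0 < e -> exists s,
    [/\ J s, a <= s, `|T s z - z| <= e & `|T s z' - z'| <= e].
Proof.
move=> rz rz' e a e0.
have /choice[t tP] (n : nat) : exists t, J t /\ n%:R <= t.
  by have [t] := time_unbounded hJ n%:R; exists t.
have Jt n := (tP n).1; have tn n := (tP n).2.
have [phi [phi_n phi_cvg]] := asymptotic_subsequence z Jt tn.
have tphi n : n%:R <= t (phi n) by rewrite (le_trans _ (tn _)) // ler_nat.
have [psi [psi_n psi_cvg]] := asymptotic_subsequence z' (fun n => Jt (phi n)) tphi.
pose r n := t (phi (psi n)).
have Jr n : J (r n) by exact: Jt.
have rn n : n%:R <= r n by rewrite (le_trans _ (tphi _)) // ler_nat.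
have d0 : 0 < e / (2 * M) by rewrite divr_gt0 // mulr_gt0.
have psi_oo : psi n @[n --> \oo] --> \oo.
  by apply/cvgnyPge => A; exists A => // n /= An; exact: leq_trans (psi_n n).
have rz_cvg : cvg (T (r n) z @[n --> \oo]).
  apply: (cvgP (lim (T (t (phi n)) z @[n --> \oo]))).
  exact: (cvg_comp _ _ psi_oo phi_cvg).
have /cvgrPdist_le/(_ _ d0)[N _ zN] := rz_cvg.
have /cvgrPdist_le/(_ _ d0)[N' _ zN'] := psi_cvg.
have [m Nm [rm rNm]] := later_index (maxn N N') a rn.
have small (u l : X) : recurrent u ->
    `|l - T (r (maxn N N')) u| <= e / (2 * M) -> `|l - T (r m) u| <= e / (2 * M) ->
    `|T (r m - r (maxn N N')) u - u| <= e.
  move=> ru h h'; rewrite (le_trans (recurrent_gap ru (Jr _) (Jr _) rNm)) //.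
  have -> : e = M * (e / (2 * M) + e / (2 * M)) by field; rewrite gt_eqF.
  rewrite ler_pM2l // -(subrKA l) (le_trans (ler_normD _ _)) //.
  by rewrite lerD // distrC.
exists (r m - r (maxn N N')); split.
- exact: timeB.
- by rewrite lerBrDl.
- apply: small rz (zN _ _) (zN _ _) => /=; first exact: leq_maxl.
  exact: leq_trans (leq_maxl _ _) Nm.
- apply: small rz' (zN' _ _) (zN' _ _) => /=; first exact: leq_maxr.
  exact: leq_trans (leq_maxr _ _) Nm.
Qed.

End recurrence.

(** * The cone of positive recurrent vectors *)

Section ordered_space.
Variables (R : realType) (X : completeNormedModType R) (P : set X).
Hypothesis hP : positive_cone P.

Lemma positive_cone_convex : convex_cone P.
Proof. by case: hP. Qed.

Lemma positive_cone_closed : closed P.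
Proof. by case: hP. Qed.

Lemma positive_cone_pointed x : P x -> P (- x) -> x = 0.
Proof.
case: hP => _ _ _ PN Px PNx; suff : [set 0] x by [].
by rewrite -PN; split=> //; exists (- x); rewrite ?opprK.
Qed.

(** A functional that separates a point from the subspace L vanishes on L, so it
    is a positive functional that is zero at p. *)
Lemma almost_interior_total p (L : set X) : almost_interior P p -> P p ->
    P `<=` L -> closed L ->
    (forall (a b : R) x y, L x -> L y -> L (a *: x + b *: y)) ->
  forall x, L x.
Proof.
move=> intp Pp PL Lcl Llin x; apply: contrapT => nLx.
have Lc : convex_cone L by split=> [|a b y z _ _]; [exists p; exact: PL|exact: Llin].
have [x' [x'L x'x]] := cone_separation Lc Lcl nLx.
have : 0 < x' p.
  apply: intp => [y Py|x'0]; first exact/x'L/PL.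
  by move: x'x; rewrite x'0 ltxx.
have := x'L ((-1) *: p + 0 *: p) (Llin _ _ _ _ (PL _ Pp) (PL _ Pp)).
by rewrite scale0r addr0 scaleN1r linearN oppr_ge0 => /le_lt_trans h /h; rewrite ltxx.
Qed.

End ordered_space.

Section irreducible.
Variables (R : realType) (X : completeNormedModType R) (P : set X) (J : set R).
Variables (T : R -> bounded_operator X X) (M : R).
Hypothesis hP : positive_cone P.
Hypothesis hJ : time_set J.
Hypothesis hT : operator_semigroup J T.
Hypothesis T_pos : positive_semigroup J P T.
Hypothesis T_interior : forall x : X, P x -> x <> 0 ->
  exists t, J t /\ almost_interior P (T t x).
Hypothesis M1 : 1 <= M.
Hypothesis TM : forall t x, J t -> `|T t x| <= M * `|x|.
Hypothesis T_compact : strongly_asymptotically_compact J T.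
Implicit Types (x y z : X).

Let M0 : 0 < M. Proof. exact: lt_le_trans M1. Qed.

Definition recurrent_cone : set X := P `&` [set z | recurrent J T z].

Lemma recurrent_cone_convex : convex_cone recurrent_cone.
Proof.
have Pc := positive_cone_convex hP; split.
  exists 0; split; first exact: convex_cone0 Pc.
  move=> e a e0; have [t Jt at_] := time_unbounded hJ a; exists t; split=> //.
  by rewrite linear0 subrr normr0 ltW.
move=> a b x y a0 b0 [Px rx] [Py ry]; split; first exact: Pc.2.
by apply: recurrent_linear_combination => e c; exact: (jointly_recurrent hJ hT M1 TM T_compact).
Qed.

Lemma recurrent_cone_closed : closed recurrent_cone.
Proof.
apply: closedI; first exact: positive_cone_closed.
exact: closed_recurrent TM.
Qed.

Lemma omega_limit (t : nat -> R) x : P x ->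
    (forall n, J (t n)) -> (forall n, n%:R <= t n) ->
  exists z, recurrent_cone z /\
    forall e : R, 0 < e -> exists n, `|z - T (t n) x| <= e.
Proof.
move=> Px Jt tn.
have [phi [phi_n phi_cvg]] := asymptotic_subsequence T_compact x Jt tn.
exists (lim (T (t (phi n)) x @[n --> \oo])); split; [split|].
- apply: (closed_cvg P (positive_cone_closed hP)) phi_cvg.
  by apply: nearW => n; exact: T_pos.
- apply: (omega_limit_recurrent hJ hT M1 TM (t := t \o phi)) phi_cvg => n //=.
  by rewrite (le_trans _ (tn _)) // ler_nat.
- move=> e e0; have /cvgrPdist_le/(_ e e0)[n _ /(_ n (leqnn n)) h] := phi_cvg.
  by exists (phi n).
Qed.

(** Orbits of positive vectors accumulate only in the cone of positive recurrent
    vectors, where x' is non-negative. *)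
Lemma asymptotically_positive (x' : dual_space X) x :
    (forall c, recurrent_cone c -> 0 <= x' c) -> P x ->
  forall e : R, 0 < e -> exists a, forall t, J t -> a <= t -> - e <= x' (T t x).
Proof.
move=> x'C Px e e0; apply: contrapT => nh.
have /choice[t tP] (n : nat) : exists t, [/\ J t, n%:R <= t & x' (T t x) < - e].
  apply: contrapT => nt; apply: nh; exists n%:R => t Jt nt'.
  by rewrite leNgt; apply/negP => tx; apply: nt; exists t.
have [K K0 x'K] := bounded_operator_Lipschitz x'.
have [||z [Cz zt]] := @omega_limit t x Px.
- by move=> n; have [] := tP n.
- by move=> n; have [] := tP n.
have d0 : 0 < e / (K + 1) by rewrite divr_gt0 // ltr_wpDl.
have [n zn] := zt _ d0; have [_ _ tx] := tP n.
have : `|x' (z - T (t n) x)| < e.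
  apply: le_lt_trans (x'K _) _; apply: le_lt_trans (ler_wpM2l K0 zn) _.
  by rewrite mulrCA gtr_pMr // ltr_pdivrMr ?ltr_wpDl // mul1r ltrDl.
rewrite linearB => /ltr_normlW.
rewrite ltrBlDl -ltrBlDr => h; have := lt_trans h tx.
by rewrite gtrDr ltNge x'C.
Qed.

(** Pulling x' back along the common return times of w and v, less the time t at
    which T t w is almost interior, yields in the limit a positive functional on
    all of P whose values at T t w and T t v are x' w and x' v.  It is non-zero
    because of v, and vanishes at T t w because of w. *)
Lemma recurrent_cone_no_support w v (x' : dual_space X) :
    recurrent_cone w -> w <> 0 -> recurrent_cone v ->
    (forall c, recurrent_cone c -> 0 <= x' c) -> x' w = 0 -> ~ 0 < x' v.
Proof.
move=> Cw w0 Cv x'C x'w x'v.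
have [t [Jt intw]] := T_interior Cw.1 w0.
have /choice[s sP] (n : nat) : exists s, [/\ J s, n%:R + t <= s,
    `|T s w - w| <= n.+1%:R^-1 & `|T s v - v| <= n.+1%:R^-1].
  by apply: (jointly_recurrent hJ hT M1 TM T_compact Cw.2 Cv.2); rewrite invr_gt0.
have ts n : t <= s n by have [_ + _ _] := sP n; apply: le_trans; rewrite lerDr.
have Js n : J (s n) by case: (sP n).
have Jst n : J (s n - t) by exact: timeB.
have [K K0 x'K] := bounded_operator_Lipschitz x'.
have [U [UU ooU]] := ultraFilterLemma eventually_filter.
have UP : ProperFilter U by exact: ultra_proper.
pose g x (n : nat) : R := x' (T (s n - t) x).
have gK x n : `|g x n| <= K * M * `|x|.
  by rewrite (le_trans (x'K _)) // -mulrA ler_wpM2l // TM.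
have g_cvg x : cvg (g x @ U) by exact: (ultrafilter_cvg UU (gK x)).
pose psi x : R^o := lim (g x @ U).
have psi_lin : linear psi.
  move=> a x y; apply: cvg_lim => //.
  rewrite (_ : g (a *: x + y) = (fun n => a * g x n + g y n)); last first.
    by apply/funext => n; rewrite /g linearP linearP.
  by apply: cvgD (g_cvg y); apply: cvgMl_tmp (g_cvg x).
pose psi_l : {linear X -> R^o} := HB.pack psi
  (GRing.isLinear.Build R X R^o *:%R psi psi_lin).
have [|y' y'E] := @bounded_operator_of _ _ _ psi_l (K * M).
  move=> x; apply: (closed_cvg [set r : R | r <= K * M * `|x|]) (cvg_norm (g_cvg x)).
    exact: closed_le.
  by apply: nearW; exact: gK.
have y'_pos : positive_functional P y'.
  move=> x Px; rewrite y'E; apply/ler_addgt0Pl => e e0.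
  rewrite -lerBlDl sub0r.
  have [a aP] := asymptotically_positive x'C Px e0.
  apply: limr_ge; first exact: g_cvg.
  apply: ooU; exists (Num.bound `|a|) => // n /= an; apply: aP => //.
  have [_ + _ _] := sP n; rewrite -lerBrDr; apply: le_trans.
  rewrite (le_trans (ler_norm a)) // (le_trans (ltW (archi_boundP _))) //.
  by rewrite ler_nat.
have psi_t u : recurrent_cone u -> (forall n, `|T (s n) u - u| <= n.+1%:R^-1) ->
    y' (T t u) = x' u.
  move=> Cu su; rewrite y'E; apply: cvg_lim => //.
  apply: (cvg_trans (cvg_fmap2 ooU)).
  rewrite (_ : g (T t u) = (fun n => x' (T (s n) u))); last first.
    by apply/funext => n; rewrite /g -(semigroup_sub hJ hT u Jt (Js n) (ts n)).
  apply: (cvg_comp (fun n => T (s n) u)); last exact: bounded_operator_continuous.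
  apply/cvgrPdist_le => e e0; have /cvgrPdist_le/(_ e e0) := @cvg_harmonic R.
  apply: filterS => n /=; rewrite sub0r normrN ger0_norm ?invr_ge0 //.
  by apply: le_trans; rewrite distrC; exact: su.
have : 0 < y' (T t w).
  apply: intw => // y'0; move: x'v; rewrite -psi_t //; last by move=> n; case: (sP n).
  by rewrite y'0 ltxx.
by rewrite psi_t ?x'w ?ltxx // => n; case: (sP n).
Qed.

(** If there is no non-zero positive recurrent vector, then y = 0; this case is
    the one in which the semigroup tends to 0. *)
Lemma recurrent_cone_line : exists2 y, recurrent_cone y &
  forall x, recurrent_cone x -> exists c : R, x = c *: y.
Proof.
have Cc := recurrent_cone_convex.
have [[y [Cy y0]]|nC] := pselect (exists y, recurrent_cone y /\ y <> 0); last first.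
  exists 0; first exact: convex_cone0 Cc.
  move=> x Cx; exists 0; rewrite scaler0; apply: contrapT => x0; apply: nC.
  by exists x.
exists y => // x Cx; apply: contrapT => xy.
have [||w [x' [Cw w0 x'C x'w x'y]]] := support_functional Cc recurrent_cone_closed Cy.
- by move=> [Ny _]; exact/y0/(positive_cone_pointed hP Cy.1 Ny).
- by exists x => // c xc; apply: xy; exists c.
exact: recurrent_cone_no_support Cw w0 Cy x'C x'w x'y.
Qed.

(** T t multiplies y by some c t >= 0, multiplicatively in t.  Boundedness gives
    c <= 1, and recurrence gives c t >= c s >= 1 - e for late return times s. *)
Lemma recurrent_cone_fixed y : recurrent_cone y ->
    (forall x, recurrent_cone x -> exists c : R, x = c *: y) ->
  forall t, J t -> T t y = y.
Proof.
move=> Cy Cline; have [y0|/eqP yn0] := eqVneq y 0.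
  by move=> t _; rewrite y0 linear0.
have ny : 0 < `|y| by rewrite normr_gt0; exact/eqP.
have /choice[c cP] (t : R) : exists c : R, J t -> T t y = c *: y.
  have [Jt|nJt] := pselect (J t); last by exists 0.
  have [|c cE] := Cline (T t y); last by exists c.
  split; first exact: T_pos Cy.1.
  exact: (recurrent_semigroup hT M1 TM Jt Cy.2).
have c_ge0 t : J t -> 0 <= c t.
  move=> Jt; rewrite leNgt; apply/negP => ct0; apply: yn0.
  apply: (positive_cone_pointed hP Cy.1).
  have -> : - y = (- c t)^-1 *: T t y.
    by rewrite (cP t Jt) scalerA invrN mulNr mulVf ?lt_eqF // scaleN1r.
  apply: convex_coneZ (positive_cone_convex hP) _ (T_pos Jt Cy.1).
  by rewrite invr_ge0 oppr_ge0 ltW.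
have cD s t : J s -> J t -> c (s + t) = c s * c t.
  move=> Js Jt; have := hT.2 t s Jt Js y; rewrite /= (cP _ (timeD hJ Js Jt)).
  rewrite (cP t Jt) linearZ /= (cP s Js) scalerA mulrC => /eqP.
  rewrite -subr_eq0 -scalerBl scaler_eq0 subr_eq0 => /orP[/eqP//|/eqP//].
have c_le t : J t -> c t <= M.
  move=> Jt; have := TM y Jt; rewrite (cP t Jt) normrZ ler_pM2r //.
  by rewrite ger0_norm // c_ge0.
pose S := [set c t | t in J].
have S_sup : has_sup S.
  by split; [exists (c 0), 0 => //; exact: time0|exists M => _ [t Jt <-]; exact: c_le].
(* if c t > 1, multiplying by c t would exceed the supremum of c *)
have c_le1 t : J t -> c t <= 1.
  move=> Jt; rewrite leNgt; apply/negP => ct1.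
  have ct0 : 0 < c t by exact: lt_trans ct1.
  have S0 : 0 < sup S.
    by apply: lt_le_trans ct0 _; apply: (ub_le_sup S_sup.2); exists t.
  suff : sup S <= sup S / c t.
    by rewrite ler_pdivlMr // leNgt ltr_pMr // ct1.
  apply: ge_sup; first exact: S_sup.1.
  move=> _ [s Js <-]; rewrite ler_pdivlMr // -cD //.
  by apply: (ub_le_sup S_sup.2); exists (s + t) => //; exact: timeD.
move=> t Jt; rewrite (cP t Jt); suff -> : c t = 1 by rewrite scale1r.
apply/le_anti; rewrite c_le1 //=; apply/ler_addgt0Pr => e e0.
have [s [Js ts]] := Cy.2 (e * `|y|) t (mulr_gt0 e0 ny).
have Jst := timeB hJ Jt Js ts.
rewrite (cP s Js) -[X in _ - X]scale1r -scalerBl normrZ ler_pM2r // distrC.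
move=> /(le_trans (ler_norm _)); rewrite lerBlDl => /le_trans; apply.
rewrite lerD2r -[s](subrK t) cD // ler_piMl //; [exact: c_ge0|exact: c_le1].
Qed.

(** An orbit that comes close to a fixed vector once remains close to it. *)
Lemma orbit_cvg y x : recurrent_cone y ->
    (forall x, recurrent_cone x -> exists c : R, x = c *: y) -> P x ->
  exists c : R, T t x @[t --> within J +oo_R] --> c *: y.
Proof.
move=> Cy Cline Px; have yfix := recurrent_cone_fixed Cy Cline.
have /choice[t tP] (n : nat) : exists t, J t /\ n%:R <= t.
  by have [t] := time_unbounded hJ n%:R; exists t.
have [z [/Cline[c ->] zt]] := omega_limit Px (fun n => (tP n).1) (fun n => (tP n).2).
exists c; have FF := proper_within_time hJ.
apply/cvgrPdist_le => e e0; have [n tn] := zt _ (divr_gt0 e0 M0).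
apply/near_timeP; exists (t n) => s Js ts; have Jt := (tP n).1.
have Jst := timeB hJ Jt Js ts.
rewrite -(yfix _ Jst) -linearZ (semigroup_sub hJ hT x Jt Js ts) -linearB.
by rewrite (le_trans (TM _ Jst)) // mulrC -ler_pdivlMr.
Qed.

End irreducible.

(** * Strong convergence *)

Section strong_limits.
Variables (R : realType) (X : completeNormedModType R) (J : set R).
Variables (T : R -> bounded_operator X X) (M : R).
Hypothesis hJ : time_set J.
Hypothesis M1 : 1 <= M.
Hypothesis TM : forall t x, J t -> `|T t x| <= M * `|x|.

Let F_proper : ProperFilter (within J +oo_R). Proof. exact: proper_within_time. Qed.
Local Existing Instance F_proper.

(** Boundedness of T keeps the orbits of nearby vectors uniformly close, so that
    Cauchy orbits are stable under limits. *)
Lemma closed_convergence :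
  closed [set x | cvg (T t x @[t --> within J +oo_R])].
Proof.
have M0 : 0 < M by exact: lt_le_trans M1.
move=> x clx; apply/cauchy_cvgP/cauchy_exP => e e0.
have d0 : 0 < e / (2 * M + 1) by rewrite divr_gt0 // addr_gt0 // mulr_gt0.
have [x' [x'_cvg]] := clx _ (nbhsx_ballx x _ d0); rewrite -ball_normE /= => xx'.
have Md : M * `|x - x'| < e - e / (2 * M + 1).
  have : M * `|x - x'| < M * (e / (2 * M + 1)) by rewrite ltr_pM2l.
  have : 0 < M * (e / (2 * M + 1)) by rewrite mulr_gt0.
  have -> : e - e / (2 * M + 1) = 2 * (M * (e / (2 * M + 1))).
    by field; rewrite gt_eqF // addr_gt0 // mulr_gt0.
  lra.
exists (lim (T t x' @[t --> within J +oo_R])); rewrite nbhs_simpl.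
have /cvgrPdist_lt/(_ _ d0)/near_timeP[a aP] := x'_cvg.
apply/near_timeP; exists a => t Jt at_.
rewrite /=.
rewrite -(subrKA (T t x')) -linearB (le_lt_trans (ler_normD _ _)) //.
have := aP t Jt at_; have := TM (x' - x) Jt; rewrite (distrC x' x); move: Md; lra.
Qed.

Lemma strong_limit :
    (forall x, cvg (T t x @[t --> within J +oo_R])) ->
  exists Q : bounded_operator X X,
    forall x, T t x @[t --> within J +oo_R] --> Q x.
Proof.
move=> Tcvg; pose q x := lim (T t x @[t --> within J +oo_R]).
have q_lin : linear q.
  move=> a x y; apply: cvg_lim => //.
  rewrite (_ : (fun t => T t _) = (fun t => a *: T t x + T t y)); last first.
    by apply/funext => t; rewrite linearP.
  by apply: cvgD (Tcvg y); apply: cvgZl_tmp (Tcvg x).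
pose q_l : {linear X -> X} := HB.pack q (GRing.isLinear.Build R X X *:%R q q_lin).
have [|Q QE] := @bounded_operator_of _ _ _ q_l M.
  move=> x; apply: (closed_cvg [set r : R | r <= M * `|x|]) (cvg_norm (Tcvg x)).
    exact: closed_le.
  by apply/near_timeP; exists 0 => t Jt _; exact: TM.
by exists Q => x; rewrite QE; exact: Tcvg.
Qed.

Hypothesis hT : operator_semigroup J T.

Lemma limit_of_orbit (Q : bounded_operator X X) t x :
    (forall z, T s z @[s --> within J +oo_R] --> Q z) -> J t ->
  Q (T t x) = Q x.
Proof.
move=> TQ Jt; suff Qx' : T s (T t x) @[s --> within J +oo_R] --> Q x.
  exact: (norm_cvg_unique (TQ (T t x)) Qx').
have /cvgrPdist_le Qx := TQ x; apply/cvgrPdist_le => e e0.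
have /near_timeP[a aP] := Qx e e0; apply/near_timeP; exists a => s Js as_.
rewrite -[T s (T t x)](hT.2 t s Jt Js); apply: aP; first exact: timeD.
by rewrite (le_trans as_) // lerDl (time_ge0 hJ).
Qed.

Lemma limit_fixed (Q : bounded_operator X X) y :
    T s y @[s --> within J +oo_R] --> Q y -> (forall t, J t -> T t y = y) ->
  Q y = y.
Proof.
move=> TQy yfix; suff Qy : T t y @[t --> within J +oo_R] --> y.
  exact: (norm_cvg_unique TQy Qy).
apply/cvgrPdist_le => e e0; apply/near_timeP; exists 0 => t Jt _.
by rewrite yfix // subrr normr0 ltW.
Qed.

End strong_limits.

(** Here x' reads off the coefficient of y.  The case y = 0 is included so that
    the limit operator can be treated uniformly. *)
Lemma cone_projection (R : realType) (X : completeNormedModType R) (P : set X) y :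
  positive_cone P -> P y ->
  exists x' : dual_space X, positive_functional P x' /\ x' y *: y = y.
Proof.
move=> hP Py; have Pc := positive_cone_convex hP.
have [y0|/eqP y0] := eqVneq y 0.
  have [|z zE] := @bounded_operator_of R X R^o \0 0.
    by move=> x; rewrite /= normr0 mul0r.
  by exists z; split=> [x _|]; rewrite ?y0 ?scaler0 // zE.
have nPNy : ~ P (- y) by move=> /(positive_cone_pointed hP Py).
have [f [fP]] := cone_separation Pc (positive_cone_closed hP) nPNy.
rewrite linearN oppr_lt0 => fy.
have [K K0 fK] := bounded_operator_Lipschitz f.
have [|z zE] := @bounded_operator_of R X R^o ((f y)^-1 \*: f) ((f y)^-1 * K).
  by move=> x; rewrite /= normrZ gtr0_norm ?invr_gt0 // -mulrA ler_pM2l ?invr_gt0.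
exists z; split=> [x Px|]; first by rewrite zE /= mulr_ge0 ?fP // invr_ge0 ltW.
by rewrite zE /= -[_ *: f y]/(_ * f y) mulVf ?scale1r // gt_eqF.
Qed.

Theorem theorem4p1 (R : realType) (X : completeNormedModType R) (P : set X)
    (hP : positive_cone P) (P_neq0 : P <> [set 0])
    (J : set R) (hJ : time_set J)
    (T : R -> bounded_operator X X)
    (hT : operator_semigroup J T) (T_pos : positive_semigroup J P T)
    (T_interior : forall x : X, P x -> x <> 0 ->
      exists t, J t /\ almost_interior P (T t x))
    (T_bounded : bounded_semigroup J T)
    (T_compact : strongly_asymptotically_compact J T) :
  exists Q : bounded_operator X X, converges_strongly J T Q /\
    (~ (Q =1 \0) ->
      exists (y : X) (y' : dual_space X),
        [/\ Q =1 rank_one y' y,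
            almost_interior P y,
            forall t, J t -> T t y = y,
            strictly_positive P y' &
            forall t, J t -> dual_operator (T t) y' =1 y']).
Proof.
have [M M1 TM] := bounded_semigroup_unif T_bounded.
have FF := proper_within_time hJ.
have [y Cy Cline] := recurrent_cone_line hP hJ hT T_pos T_interior M1 TM T_compact.
have yfix := recurrent_cone_fixed hP hJ hT T_pos M1 TM Cy Cline.
have P_orbit := orbit_cvg hP hJ hT T_pos M1 TM T_compact Cy Cline.
have [p intp Pp] : exists2 p, almost_interior P p & P p.
  have [x [Px x0]] : exists x, P x /\ x <> 0.
    apply: contrapT => nx; apply: P_neq0; apply/seteqP; split=> [x Px|_ ->].
      by apply: contrapT => x0; apply: nx; exists x.
    exact: convex_cone0 (positive_cone_convex hP).
  by have [t [Jt int]] := T_interior x Px x0; exists (T t x) => //; exact: T_pos.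
have Tcvg : forall x, cvg (T t x @[t --> within J +oo_R]).
  apply: (almost_interior_total intp Pp _ (closed_convergence hJ M1 TM)).
    by move=> x /P_orbit[c xc]; apply: cvgP xc.
  move=> a b x z /= xcvg zcvg.
  rewrite (_ : (fun t => T t _) = (fun t => a *: T t x + b *: T t z)); last first.
    by apply/funext => t; rewrite linearD !linearZ.
  by apply: is_cvgD; exact: is_cvgZl_tmp.
have [Q TQ] := strong_limit hJ TM Tcvg.
exists Q; split.
  move=> x; rewrite -(normr0 X) -(subrr (Q x)).
  by apply: cvg_norm; apply: cvgB (TQ x) _; exact: cvg_cst.
move=> Qn0; have [f [fP fy]] := cone_projection hP Cy.1.
have Qy := limit_fixed hJ (TQ y) yfix.
have QE : forall x, Q x - f (Q x) *: y = 0.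
  have QE_closed : closed [set x | Q x - f (Q x) *: y = 0].
    apply: (@preimage_closed _ _ (fun x => Q x - f (Q x) *: y) [set 0]); last first.
      exact: accessible_closed_set1 (hausdorff_accessible (@norm_hausdorff R X)) 0.
    move=> x _; apply: cvgB; first exact: bounded_operator_continuous.
    apply: cvgZr_tmp; apply: (@bounded_operator_continuous _ _ _ (dual_operator Q f)).
  apply: (almost_interior_total intp Pp _ QE_closed).
    move=> x Px /=; have [c xc] := P_orbit x Px.
    have -> : Q x = c *: y by exact: norm_cvg_unique (TQ x) xc.
    by rewrite functionalZ -scalerA fy subrr.
  move=> a b x z /= Qx Qz.
  have -> : Q (a *: x + b *: z) = a *: Q x + b *: Q z by rewrite linearD !linearZ.
  rewrite linearD !functionalZ scalerDl opprD addrACA -!scalerA -!scalerBr.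
  by rewrite Qx Qz !scaler0 addr0.
have y0 : y <> 0.
  move=> y0; apply: Qn0 => x; have /eqP := QE x.
  by rewrite y0 scaler0 subr0 => /eqP.
have inty : almost_interior P y.
  by have [t [Jt]] := T_interior y Cy.1 y0; rewrite yfix.
have y'fix t : J t -> dual_operator (T t) (dual_operator Q f) =1 dual_operator Q f.
  by move=> Jt x /=; rewrite (limit_of_orbit hJ hT _ TQ).
exists y, (dual_operator Q f); split=> //.
  by move=> x; have /eqP := QE x; rewrite subr_eq0 => /eqP.
move=> x Px x0; have [t [Jt intx]] := T_interior x Px x0.
rewrite -(y'fix t Jt); apply: intx => [z Pz|y'0].
  apply: fP; apply: (closed_cvg P (positive_cone_closed hP) _ _ (TQ z)).
  by apply/near_timeP; exists 0 => s Js _; exact: T_pos.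
by apply: y0; rewrite -fy; have := y'0 y; rewrite /= Qy => ->; rewrite scale0r.
Qed.
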